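(* Let $T$ be a strongly Cesàro bounded operator on a complex Banach space $X$. Let $q,q^*\in[2,\infty]$ be such that $X$ has cotype $q$ and its dual $X^*$ has cotype $q^*$, and put $s=\min(q,q^* )$. Then $\|T^n\|=O\big(n/(\log n)^{1/s}\big)$ as $n\to\infty$ (with $1/s=0$ if $s=\infty$); in particular, if $s$ is finite, $\|T^n\|=o(n)$.
   Context: A bounded linear operator $T$ on $X$ is strongly Cesàro bounded if there is $C>0$ such that $\sup_{n\ge1}\frac1n\sum_{k=0}^{n-1}|\langle x^*,T^kx\rangle|\le C\|x^*\|\,\|x\|$ for all $(x,x^* )\in X\times X^*$. Let $\varepsilon_1,\dots,\varepsilon_n$ be iid Rademacher variables (values $\pm1$ with probability $1/2$ each). A Banach space $Y$ has (finite) cotype $q\in[2,\infty)$ if there is $K>0$ such that for all $n\ge1$ and $y_1,\dots,y_n\in Y$, $\|y_1\|^q+\dots+\|y_n\|^q\le K\,\mathbb{E}(\|\varepsilon_1y_1+\dots+\varepsilon_ny_n\|^q)$. It has cotype $\infty$ if there is $K>0$ such that for all such $n$ and $y_i$, $\max_{1\le i\le n}\|y_i\|\le K\,\mathbb{E}(\|\varepsilon_1y_1+\dots+\varepsilon_ny_n\|)$; every Banach space has cotype $\infty$. *)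

(* Defs.v *)
From HB Require Import structures.
From mathcomp Require Import all_boot all_order all_algebra.
From mathcomp Require Import all_classical all_reals all_analysis.
From mathcomp Require Import complex.

Set Implicit Arguments.
Unset Strict Implicit.
Unset Printing Implicit Defensive.

Import Order.TTheory GRing.Theory Num.Theory.
Import numFieldNormedType.Exports.

Local Open Scope classical_set_scope.
Local Open Scope ring_scope.

(* In a [normedModType R[i]] the norm [`|x|] takes its values in [R[i]];
   [rnorm x] is the same number seen in [R]. *)
Definition rnorm (R : realType) (V : normedModType R[i]) (x : V) : R :=
  complex.Re `|x|.

Section rnorm_theory.
Variables (R : realType) (V : normedModType R[i]).
Implicit Types x y : V.

Lemma rnormE x : (rnorm x)%:C%C = `|x|.
Proof. by rewrite /rnorm RRe_real ?normr_real. Qed.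

Lemma rnorm_ge0 x : 0 <= rnorm x.
Proof. by rewrite -lecR rnormE normr_ge0. Qed.

Lemma ler_rnormD x y : rnorm (x + y) <= rnorm x + rnorm y.
Proof. by rewrite -lecR rmorphD/= !rnormE ler_normD. Qed.

Lemma rnormZ (a : R[i]) x : rnorm (a *: x) = rnorm (a : R[i]^o) * rnorm x.
Proof.
apply: (@complexI R); rewrite rmorphM/= !rnormE normrZ.
by congr (_ * _).
Qed.

Lemma rnorm0 : rnorm (0 : V) = 0.
Proof. by rewrite /rnorm normr0. Qed.

Lemma rnorm0_eq0 x : rnorm x = 0 -> x = 0.
Proof. by move=> x0; apply/normr0_eq0; rewrite -rnormE x0. Qed.

End rnorm_theory.

(* Meaningful for bounded linear [f] only: [sup] is [0] on unbounded sets. *)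
Definition opnorm (R : realType) (V W : normedModType R[i]) (f : V -> W) : R :=
  sup [set rnorm (f x) | x in [set x | rnorm x <= 1]].

Section opnorm_theory.
Variables (R : realType) (V W : normedModType R[i]) (f : {linear V -> W}).
Hypothesis cf : continuous f.

Lemma opnorm_has_sup : has_sup [set rnorm (f x) | x in [set x | rnorm x <= 1]].
Proof.
split; first by exists (rnorm (f 0)), 0 => //=; rewrite rnorm0 ler01.
have /linear_bounded_continuous/bounded_funP/(_ 1)[M fM] := cf.
exists (complex.Re M) => _ [x /= x1 <-].
have : `|f x| <= M by apply: fM; rewrite -rnormE -[1]/((1 : R)%:C%C) lecR.
by rewrite -rnormE lecE /= => /andP[].
Qed.

Lemma ler_opnorm x : rnorm (f x) <= opnorm f * rnorm x.
Proof.
have [->|x0] := eqVneq x 0; first by rewrite linear0 !rnorm0 mulr0.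
have nx0 : 0 < rnorm x.
  by rewrite lt_neqAle rnorm_ge0 andbT eq_sym; apply: contra_neq x0 => /rnorm0_eq0.
have nV : rnorm (((rnorm x)^-1)%:C%C : R[i]^o) = (rnorm x)^-1.
  by rewrite /rnorm ger0_norm// -[0]/((0 : R)%:C%C) lecR invr_ge0 rnorm_ge0.
rewrite -ler_pdivrMr// mulrC.
have -> : (rnorm x)^-1 * rnorm (f x) = rnorm (f (((rnorm x)^-1)%:C%C *: x)).
  by rewrite linearZ/= rnormZ nV.
apply: sup_upper_bound; first exact: opnorm_has_sup.
exists (((rnorm x)^-1)%:C%C *: x) => //=.
by rewrite rnormZ nV mulVf// gt_eqF.
Qed.

Lemma opnorm_ge0 : 0 <= opnorm f.
Proof.
apply: (le_trans (rnorm_ge0 (f 0))).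
apply: sup_upper_bound; first exact: opnorm_has_sup.
by exists 0 => //=; rewrite rnorm0 ler01.
Qed.

Lemma opnorm_le (M : R) :
  (forall x, rnorm x <= 1 -> rnorm (f x) <= M) -> opnorm f <= M.
Proof.
move=> fM; apply: ge_sup; first by case: opnorm_has_sup.
by move=> _ [x /= x1 <-]; exact: fM.
Qed.

End opnorm_theory.

Section dual.
Variables (R : realType) (X : normedModType R[i]).

Definition dual_pred : {pred X -> R[i]^o} :=
  mem [set f : X -> R[i]^o | linear f /\ continuous f].

Record dual := Dual {
  dual_fun :> X -> R[i]^o ;
  dual_funP : dual_fun \in dual_pred }.

HB.instance Definition _ := [isSub for dual_fun].
HB.instance Definition _ := [Choice of dual by <:].

Lemma dual_pred_submod : submod_closed dual_pred.
Proof.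
split; first by rewrite inE; split; [by move=> a x y; rewrite scaler0 addr0|
  exact: cst_continuous].
move=> a f g; rewrite !inE => -[lf cf] [lg cg]; split.
  move=> b x y.
  rewrite /= !fctE lf lg !scalerDr !scalerA [a * b]mulrC.
  by rewrite addrACA.
move=> x; apply: continuousD; last exact: cg.
by apply: continuousZl_tmp; exact: cf.
Qed.

HB.instance Definition _ :=
  GRing.isSubmodClosed.Build R[i] (X -> R[i]^o) dual_pred dual_pred_submod.
HB.instance Definition _ := [SubChoice_isSubLmodule of dual by <:].

Lemma dual_linear (f : dual) : linear f.
Proof. by case: f => f /=; rewrite inE => -[]. Qed.

HB.instance Definition _ (f : dual) :=
  GRing.isLinear.Build R[i] X R[i]^o *:%R (dual_fun f) (dual_linear f).

Lemma dual_continuous (f : dual) : continuous f.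
Proof. by case: f => f /=; rewrite inE => -[]. Qed.

Definition dual_norm (f : dual) : R[i] := (opnorm f)%:C%C.

Lemma dual_ler_normD f g : dual_norm (f + g) <= dual_norm f + dual_norm g.
Proof.
rewrite /dual_norm -rmorphD lecR.
apply: (opnorm_le (@dual_continuous (f + g))) => x x1.
rewrite -[X in rnorm X]/(f x + g x : R[i]^o) (le_trans (ler_rnormD _ _))// lerD//.
  rewrite (le_trans (ler_opnorm (@dual_continuous f) x))//.
  by rewrite ler_piMr// (opnorm_ge0 (@dual_continuous f)).
rewrite (le_trans (ler_opnorm (@dual_continuous g) x))//.
by rewrite ler_piMr// (opnorm_ge0 (@dual_continuous g)).
Qed.

Lemma dual_normZ_le (a : R[i]) f : dual_norm (a *: f) <= `|a| * dual_norm f.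
Proof.
rewrite -[`|a|]/(`|a : R[i]^o|) -rnormE /dual_norm -rmorphM lecR.
apply: (opnorm_le (@dual_continuous (a *: f))) => x x1.
rewrite -[X in rnorm X]/(a *: f x : R[i]^o) rnormZ ler_wpM2l ?rnorm_ge0//.
rewrite (le_trans (ler_opnorm (@dual_continuous f) x))//.
by rewrite ler_piMr// (opnorm_ge0 (@dual_continuous f)).
Qed.

Lemma dual_normZ (a : R[i]) f : dual_norm (a *: f) = `|a| * dual_norm f.
Proof.
apply/le_anti; rewrite dual_normZ_le/=.
have [->|a0] := eqVneq a 0.
  by rewrite normr0 mul0r lecR (opnorm_ge0 (@dual_continuous (0 *: f))).
rewrite -ler_pdivlMl ?normr_gt0// -normfV -[X in dual_norm X <= _](scalerK a0).
exact: dual_normZ_le.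
Qed.

Lemma dual_norm0_eq0 f : dual_norm f = 0 -> f = 0.
Proof.
move=> [f0]; apply/val_inj/funext => x /=.
apply: rnorm0_eq0; apply/eqP; rewrite eq_le rnorm_ge0 andbT.
by rewrite (le_trans (ler_opnorm (@dual_continuous f) x))// f0 mul0r.
Qed.

HB.instance Definition _ := Lmodule_isNormed.Build R[i] dual
  dual_ler_normD dual_normZ dual_norm0_eq0.

(* The norm of [dual] takes values in [R[i]], like that of any
   [normedModType R[i]]; its real-valued form is the usual dual norm. *)
Lemma rnorm_dualE (f : dual) : rnorm f = opnorm f.
Proof. by []. Qed.

End dual.

(* Expectation over a uniformly distributed [e] in the [2 ^ n] sign patterns, which
   is the joint law of [n] iid Rademacher variables; the bit [e i] encodes the
   sign [(-1) ^+ e i]. *)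
Definition rademacher_mean (R : realType) (n : nat)
    (F : {ffun 'I_n -> bool} -> R) : R :=
  (2 ^+ n)^-1 * \sum_e F e.

Definition rademacher_sum (R : realType) (Y : normedModType R[i]) (n : nat)
    (y : 'I_n -> Y) (e : {ffun 'I_n -> bool}) : Y :=
  \sum_(i < n) (-1) ^+ e i *: y i.

Definition finite_cotype (R : realType) (Y : normedModType R[i]) (q : R) : Prop :=
  exists2 K : R, 0 < K & forall (n : nat) (y : 'I_n -> Y), (0 < n)%N ->
    \sum_(i < n) rnorm (y i) `^ q <=
      K * rademacher_mean (fun e => rnorm (rademacher_sum y e) `^ q).

Definition infinite_cotype (R : realType) (Y : normedModType R[i]) : Prop :=
  exists2 K : R, 0 < K & forall (n : nat) (y : 'I_n -> Y), (0 < n)%N ->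
    \big[Order.max/0]_(i < n) rnorm (y i) <=
      K * rademacher_mean (fun e => rnorm (rademacher_sum y e)).

Definition cotype (R : realType) (Y : normedModType R[i]) (q : \bar R) : Prop :=
  match q with
  | r%:E => 2 <= r /\ finite_cotype Y r
  | +oo%E => infinite_cotype Y
  | -oo%E => False
  end.

Definition strongly_cesaro_bounded (R : realType) (X : normedModType R[i])
    (T : X -> X) : Prop :=
  exists2 C : R, 0 < C & forall (x : X) (f : dual X) (n : nat), (0 < n)%N ->
    n%:R^-1 * \sum_(k < n) rnorm (f (iter k T x)) <= C * rnorm f * rnorm x.

(* Main.v *)
(* Write [C] for the strong Cesaro constant. Duality (Hahn-Banach) turns strong
   Cesaro boundedness into [|| \sum_(k < n) a_k T^k || <= C n] for all scalars
   with [|a_k| <= 1], and the adjoint of [T] inherits this bound. Let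
   [M = 2 ^ j <= n / 2]. For random signs [e_k],
     [M T^n x = E ((\sum_k e_k T^(n - k)) (\sum_k e_k T^k x))],
   where [M <= n - k < 2 M], and the first factor has norm at most [2 C M]. So some
   signed block [y_j = \sum_k e_k T^k x] satisfies [|| T^n x || <= 2 C || y_j ||].
   There are about [log n] disjoint blocks, and every signed sum of the [y_j] has
   norm at most [C (n + 1) || x ||], so cotype [q] gives
   [log n || T^n x || ^ q = O (n ^ q || x || ^ q)]. Applying the same argument to
   the adjoint yields the exponent [q']. *)
From HB Require Import structures.
Require Import Defs.
From mathcomp Require Import all_boot all_order all_algebra.
From mathcomp Require Import all_classical all_reals all_analysis.
From mathcomp Require Import complex ring lra.

Set Implicit Arguments.
Unset Strict Implicit.
Unset Printing Implicit Defensive.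

Import Order.TTheory GRing.Theory Num.Theory.
Import numFieldNormedType.Exports.

Local Open Scope classical_set_scope.
Local Open Scope ring_scope.

(** * Real Hahn-Banach theorem through minimal sublinear functionals *)

Section sublinear.
Context {R : realType} {E : lmodType R[i]}.
Implicit Types (p q : E -> R) (x y z : E).

(** Scalars are real and positive, and homogeneity is only an inequality, a form that infima
    inherit; applying it to [c^-1] gives the equality in [sublinearZ]. *)
Definition sublinear p :=
  (forall x y, p (x + y) <= p x + p y) /\
  (forall (c : R) x, 0 < c -> p (c%:C%C *: x) <= c * p x).

Lemma sublinear0 p : sublinear p -> p 0 = 0.
Proof.
move=> [pD pZ]; have := pD 0 0; have := pZ 2^-1 0.
rewrite scaler0 addr0; lra.
Qed.

Lemma sublinearZ p (c : R) x : sublinear p -> 0 <= c -> p (c%:C%C *: x) = c * p x.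
Proof.
move=> sp; rewrite le_eqVlt => /predU1P[<-|c0].
  by rewrite scale0r mul0r sublinear0.
apply/le_anti; rewrite (proj2 sp)//= mulrC -ler_pdivlMr// mulrC.
have := proj2 sp c^-1 (c%:C%C *: x).
by rewrite scalerA -rmorphM mulVf ?gt_eqF// scale1r invr_gt0 => /(_ c0).
Qed.

Lemma sublinearN_ge0 p x : sublinear p -> 0 <= p x + p (- x).
Proof. by move=> sp; rewrite -(sublinear0 sp) -(subrr x); exact: (proj1 sp). Qed.

(* The largest sublinear [r <= p] such that [r (- y) <= - p y]. *)
Definition directional_inf p y x :=
  inf [set r | exists2 t : R, 0 <= t & r = p (x + t%:C%C *: y) - t * p y].

Section directional_inf.
Variables (p : E -> R) (y : E).
Hypothesis sp : sublinear p.

(** Follows from [t * p y = p (t y)] and [t y = (x + t y) - x]; it makes the infimum a genuine one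
    rather than a default value. *)
Lemma directional_inf_lbound x :
  lbound [set r | exists2 t : R, 0 <= t & r = p (x + t%:C%C *: y) - t * p y] (- p (- x)).
Proof.
move=> _ [t t0 ->]; rewrite -(sublinearZ y sp t0) lerBrDr addrC lerBlDr.
by rewrite (le_trans _ (proj1 sp _ _))// addrAC subrr add0r.
Qed.

Lemma directional_inf_le x (t : R) : 0 <= t ->
  directional_inf p y x <= p (x + t%:C%C *: y) - t * p y.
Proof.
move=> t0; apply: ge_inf; last by exists t.
by exists (- p (- x)); exact: directional_inf_lbound.
Qed.

Lemma le_directional_inf x (m : R) :
  (forall t : R, 0 <= t -> m <= p (x + t%:C%C *: y) - t * p y) ->
  m <= directional_inf p y x.
Proof.
move=> h; apply: lb_le_inf; first by exists (p (x + 0%:C%C *: y) - 0 * p y), 0.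
by move=> _ [t t0 ->]; exact: h.
Qed.

Lemma directional_inf_le_self x : directional_inf p y x <= p x.
Proof.
by have := directional_inf_le x (lexx 0); rewrite scale0r mul0r addr0 subr0.
Qed.

Lemma directional_infN : directional_inf p y (- y) <= - p y.
Proof.
have := directional_inf_le (- y) ler01.
by rewrite scale1r mul1r addNr (sublinear0 sp) sub0r.
Qed.

Lemma sublinear_directional_inf : sublinear (directional_inf p y).
Proof.
split=> [x z|c x c0].
  rewrite -lerBlDr; apply: le_directional_inf => t t0.
  rewrite lerBlDr -lerBlDl; apply: le_directional_inf => s s0.
  (* The parameter [t + s] for [x + z] combines [t] for [x] with [s] for [z]. *)
  rewrite lerBlDr (le_trans (directional_inf_le _ (addr_ge0 t0 s0)))//.
  rewrite rmorphD/= scalerDl addrACA.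
  have := proj1 sp (x + t%:C%C *: y) (z + s%:C%C *: y).
  lra.
rewrite -ler_pdivrMl//; apply: le_directional_inf => t t0.
rewrite ler_pdivrMl// (le_trans (directional_inf_le _ (mulr_ge0 (ltW c0) t0)))//.
rewrite rmorphM/= -scalerA -scalerDr.
have := proj2 sp c (x + t%:C%C *: y) c0; lra.
Qed.

End directional_inf.

(** Zorn's lemma for the reversed pointwise order below [p]: a nonempty chain is bounded by its
    pointwise infimum, finite since [- p (- x) <= - q (- x) <= q x]. *)
Lemma minimal_sublinear_exists p : sublinear p ->
  exists q, [/\ sublinear q, (forall x, q x <= p x) &
    forall r, sublinear r -> (forall x, r x <= q x) -> r = q].
Proof.
move=> sp.
pose T := {q : E -> R | sublinear q /\ forall x, q x <= p x}.
pose le (q r : T) := `[< forall x, sval r x <= sval q x >].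
have lbA (A : set T) x : lbound [set sval q x | q in A] (- p (- x)).
  move=> _ [[q [sq qp]] _ <-] /=.
  have := sublinearN_ge0 x sq; have := qp (- x); lra.
have [||||q qmin] := @Zorn T le.
- by move=> q; apply/asboolP.
- by move=> q r s /asboolP qr /asboolP rs; apply/asboolP => x; exact: le_trans (rs x) (qr x).
- move=> [q Pq] [r Pr] /asboolP/= qr /asboolP/= rq; apply: eq_exist.
  by apply/funext => x; apply/le_anti; rewrite qr rq.
- move=> A Atot; have [->|/set0P[q0 Aq0]] := eqVneq A set0.
    by exists (exist _ p (conj sp (fun=> lexx _))).
  pose m x := inf [set sval q x | q in A].
  have m_le (q : T) x : A q -> m x <= sval q x.
    by move=> Aq; apply: ge_inf; [exists (- p (- x)); exact: lbA|exists q].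
  have m_ge x a : (forall q : T, A q -> a <= sval q x) -> a <= m x.
    move=> h; apply: lb_le_inf; first by exists (sval q0 x), q0.
    by move=> _ [q Aq <-]; exact: h.
  have sm : sublinear m.
    split=> [x y|c x c0].
      rewrite -lerBlDr; apply: (m_ge) => q Aq.
      rewrite lerBlDr -lerBlDl; apply: (m_ge) => r Ar.
      rewrite lerBlDr.
      (* The smaller of the two chain members [q] and [r] serves for both [x] and [y]. *)
      have [s As [sq sr]] : exists2 s, A s &
          (forall z, sval s z <= sval q z) /\ (forall z, sval s z <= sval r z).
        by case: (Atot q r Aq Ar) => /asboolP qr; [exists r|exists q].
      rewrite (le_trans (m_le s _ As))//.
      have := (proj1 (proj1 (proj2_sig s))) x y; have := sq x; have := sr y; lra.
    rewrite -ler_pdivrMl//; apply: (m_ge) => q Aq.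
    rewrite ler_pdivrMl// (le_trans (m_le q _ Aq))//.
    exact: (proj2 (proj1 (proj2_sig q))).
  have mp x : m x <= p x.
    by rewrite (le_trans (m_le q0 _ Aq0))//; exact: (proj2 (proj2_sig q0)).
  by exists (exist _ m (conj sm mp)) => q Aq; apply/asboolP => x; exact: m_le.
exists (sval q); case: q qmin => q [sq qp] qmin /=; split=> // r sr rq.
have rp x : r x <= p x by exact: le_trans (rq x) (qp x).
by have /(congr1 sval) := qmin (exist _ r (conj sr rp)) (asboolT rq).
Qed.

(** Minimality forces [directional_inf q y = q], and the former is at most [- q y] at [- y]. *)
Lemma minimal_sublinear_odd q : sublinear q ->
  (forall r, sublinear r -> (forall x, r x <= q x) -> r = q) ->
  forall y, q (- y) = - q y.
Proof.
move=> sq qmin y; apply/le_anti/andP; split; last by have := sublinearN_ge0 y sq; lra.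
rewrite -[X in X _ <= _](qmin (directional_inf q y)).
- exact: directional_infN.
- exact: sublinear_directional_inf.
- exact: directional_inf_le_self.
Qed.

(* A minimal sublinear functional [f <= p] is linear; starting the minimization
   from [directional_inf p x0] forces [f (- x0) <= - p x0]. *)
Lemma real_hahn_banach p x0 : sublinear p ->
  exists f : E -> R, [/\ (forall x y, f (x + y) = f x + f y),
    (forall (c : R) x, f (c%:C%C *: x) = c * f x),
    (forall x, f x <= p x) & f x0 = p x0].
Proof.
move=> sp; have [f [sf fle fmin]] := minimal_sublinear_exists (sublinear_directional_inf x0 sp).
have fN := minimal_sublinear_odd sf fmin.
have fp x : f x <= p x by exact: le_trans (fle x) (directional_inf_le_self _ sp _).
exists f; split => //.
- move=> x y; apply/le_anti; rewrite (proj1 sf)/=.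
  have := proj1 sf (x + y) (- y); rewrite fN addrK; lra.
- move=> c x; have [c0|/ltW c0] := leP 0 c; first exact: sublinearZ.
  rewrite -[c]opprK rmorphN/= scaleNr fN sublinearZ ?oppr_ge0//; lra.
- apply/le_anti; rewrite fp/= -lerN2 -fN (le_trans (fle _))//.
  exact: directional_infN.
Qed.

End sublinear.

(** * Norming functionals on a complex normed space *)

Section norming_functional.
Context {R : realType} {X : normedModType R[i]}.

Lemma sublinear_rnorm : sublinear (@rnorm R X).
Proof.
split=> [x y|c x c0]; first exact: ler_rnormD.
by rewrite rnormZ /rnorm normc_def/= expr0n/= addr0 sqrtr_sqr gtr0_norm.
Qed.

Lemma rnorm_regularE (z : R[i]) : rnorm (z : R[i]^o) = complex.Re `|z|.
Proof. by []. Qed.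

Lemma norming_functional (x0 : X) :
  exists f : dual X, rnorm f <= 1 /\ rnorm (f x0) = rnorm x0.
Proof.
have [f [fD fZ fle fx0]] := real_hahn_banach x0 sublinear_rnorm.
(* The complex-linear functional with real part [f]. *)
pose g x : R[i]^o := (f x +i* - f ('i%C *: x))%C.
have glin : linear g.
  move=> a x y.
  have aE : a = (complex.Re a)%:C%C + (complex.Im a)%:C%C * 'i%C.
    by case: a => u v; simpc.
  have fa z : f (a *: z) = complex.Re a * f z + complex.Im a * f ('i%C *: z).
    by rewrite {1}aE scalerDl fD -scalerA !fZ.
  have fi : f ('i%C *: (a *: x)) = complex.Re a * f ('i%C *: x) - complex.Im a * f x.
    rewrite scalerA mulrC -scalerA fa scalerA.
    have -> : 'i%C * 'i%C = (-1)%:C%C :> R[i] by simpc.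
    by rewrite fZ mulN1r mulrN.
  rewrite /g scalerDr !fD fi fa; case: a {aE fa fi} => u v.
  apply/eqP; rewrite eq_complex/=; apply/andP; split; apply/eqP; lra.
have gle x : rnorm (g x) <= rnorm x.
  have [->|gx0] := eqVneq (g x) 0; first by rewrite rnorm0 rnorm_ge0.
  (* Multiplying [x] by the unimodular [l] turns the value of [g] into its modulus, which is real
     and hence equal to [f (l *: x)]. *)
  pose z : R[i] := g x; pose l : R[i] := `|z| / z.
  have l1 : rnorm (l : R[i]^o) = 1.
    by rewrite rnorm_regularE normrM normfV normr_id divff ?normr_eq0.
  have gl : g (l *: x) = `|z|.
    have g0 : g 0 = 0.
      have := fZ 0 0; rewrite scaler0 mul0r => f0.
      by rewrite /g scaler0 f0 oppr0.
    by have := glin l x 0; rewrite g0 !addr0 => ->; rewrite /GRing.scale/= divfK.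
  have -> : rnorm (g x) = f (l *: x) by rewrite /rnorm -gl.
  by rewrite (le_trans (fle _))// rnormZ l1 mul1r.
have gc : continuous g.
  pose G := GRing.isLinear.Build R[i] X R[i]^o *:%R g glin.
  pose g' : {linear X -> R[i]^o} := HB.pack g G.
  apply: (bounded_linear_continuous (f := g')); apply/bounded_funP => r.
  by exists r => x; apply: le_trans; rewrite -!rnormE lecR; exact: gle.
have gd : g \in @dual_pred R X by rewrite inE.
pose h := Dual gd.
have hle : rnorm h <= 1.
  apply: (opnorm_le (@dual_continuous R X h)) => x x1.
  exact: le_trans (gle x) x1.
(* Conversely, the modulus of [g x0] dominates its real part [f x0 = rnorm x0]. *)
exists h; split=> //; apply/le_anti; rewrite gle/= -fx0 -lecR rnormE.
apply: le_trans (normc_ge_Re (g x0)); rewrite lecR ler_norm//.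
Qed.

(** The form in which Hahn-Banach is used: vector norms are estimated by testing against
    functionals. *)
Lemma le_rnorm_dual (x : X) (M : R) :
  (forall f : dual X, rnorm (f x) <= M * rnorm f) -> 0 <= M -> rnorm x <= M.
Proof.
move=> fM M0; have [f [f1 <-]] := norming_functional x.
by rewrite (le_trans (fM f))// ler_piMr.
Qed.

End norming_functional.

(** * Random signs and decoupling *)

Section signs.
Context {R : realType} {Y : normedModType R[i]}.

Lemma rnorm_sum (I : Type) (r : seq I) (P : pred I) (F : I -> Y) :
  rnorm (\sum_(i <- r | P i) F i) <= \sum_(i <- r | P i) rnorm (F i).
Proof.
elim/big_ind2: _ => [|a b c d ab cd|i _]; rewrite ?rnorm0//.
by rewrite (le_trans (ler_rnormD _ _))// lerD.
Qed.

Lemma rnorm_real (c : R) : rnorm (c%:C%C : R[i]^o) = `|c|.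
Proof. by rewrite rnorm_regularE normc_def/= expr0n/= addr0 sqrtr_sqr. Qed.

Lemma rnorm_sign (n : nat) : rnorm ((-1) ^+ n : R[i]^o) = 1.
Proof. by rewrite rnorm_regularE normr_sign. Qed.

(** For [i != j], flipping the sign at [i] permutes the patterns and negates each product, so the
    sum equals its opposite. *)
Lemma sum_sign_orthogonal (I : finType) (i j : I) :
  \sum_(e : {ffun I -> bool}) (-1) ^+ e i * (-1) ^+ e j =
    (2 ^+ #|I|) *+ (i == j) :> R[i].
Proof.
have [->|ij] := eqVneq i j.
  under eq_bigr do rewrite -signr_addb addbb expr0.
  by rewrite sumr_const card_ffun card_bool natrX.
pose flip (e : {ffun I -> bool}) := [ffun k => (k == i) (+) e k].
have flipK : involutive flip by move=> e; apply/ffunP => k; rewrite !ffunE addKb.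
rewrite mulr0n; set s := (X in X = 0).
suff : s = - s by move/eqP; rewrite -addr_eq0 -mulr2n mulrn_eq0/= => /eqP.
rewrite {1}/s (reindex_inj (inv_inj flipK)) -sumrN; apply: eq_bigr => e _.
by rewrite !ffunE eqxx eq_sym (negPf ij) signr_addb expr1 mulN1r mulNr.
Qed.

(* By orthogonality of the signs, the sum of the [A i (v i)]
   is the average over [e] of [(\sum_i e_i A_i) (\sum_j e_j v_j)]. *)
Lemma exists_sign_decoupling (I : finType) (P : pred I) (A : I -> {linear Y -> Y})
    (v : I -> Y) (B : R) :
  (forall (e : I -> bool) w, rnorm (\sum_(i | P i) (-1) ^+ e i *: A i w) <= B * rnorm w) ->
  exists e : I -> bool, rnorm (\sum_(i | P i) A i (v i)) <=
    B * rnorm (\sum_(i | P i) (-1) ^+ e i *: v i).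
Proof.
move=> AB.
pose W (e : I -> bool) := \sum_(i | P i) (-1) ^+ e i *: v i.
have avg : (2 ^+ #|I| : R[i]) *: \sum_(i | P i) A i (v i) =
    \sum_(e : {ffun I -> bool}) \sum_(i | P i) (-1) ^+ e i *: A i (W e).
  rewrite exchange_big/= scaler_sumr; apply: eq_bigr => i Pi.
  under eq_bigr => e _.
    rewrite linear_sum scaler_sumr.
    under eq_bigr do rewrite linearZ/= scalerA.
    over.
  rewrite exchange_big/=; under eq_bigr do rewrite -scaler_suml sum_sign_orthogonal.
  by rewrite (bigD1 i)//= eqxx mulr1n big1 ?addr0// => j /andP[_ /negPf];
    rewrite eq_sym => ->; rewrite mulr0n scale0r.
(* A pattern maximizing the bound controls the whole average; [e0] shows that patterns exist. *)
pose e0 : {ffun I -> bool} := [ffun=> false].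
case: (@arg_maxP _ _ _ e0 xpredT (fun e : {ffun I -> bool} => B * rnorm (W e)) isT) => e _ emax.
exists e; have c0 : 0 < 2 ^+ #|I| :> R by rewrite exprn_gt0.
rewrite -(ler_pM2l c0) -{1}(ger0_norm (ltW c0)) -rnorm_real -rnormZ.
rewrite rmorphXn/= rmorph_nat avg (le_trans (rnorm_sum _ _ _))//.
rewrite -natrX -card_bool -card_ffun mulr_natl -sumr_const ler_sum// => d _.
exact: le_trans (AB _ _) (emax _ isT).
Qed.

End signs.

(** * Logarithmic gain from finite cotype *)

Lemma ler_mul_powR_inv (R : realType) (q a b c d : R) : 0 < q ->
  0 <= a -> 0 <= b -> 0 <= c -> 0 <= d ->
  a * b `^ q <= c * d `^ q -> a `^ q^-1 * b <= c `^ q^-1 * d.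
Proof.
move=> q0 a0 b0 c0 d0 abcd.
have powK (x : R) : 0 <= x -> (x `^ q) `^ q^-1 = x.
  by move=> x0; rewrite -powRrM mulfV ?gt_eqF// powRr1.
have q'0 : 0 <= q^-1 by rewrite invr_ge0 ltW.
have := ge0_ler_powR q'0 _ _ abcd; rewrite !nnegrE !mulr_ge0 ?powR_ge0//.
rewrite (powRM _ a0 (powR_ge0 b q)) (powRM _ c0 (powR_ge0 d q)) powK// powK//.
by apply.
Qed.

Section cotype_growth.
Context {R : realType} {Y : normedModType R[i]}.

Lemma linear_iter (S : {linear Y -> Y}) n : linear (iter n S).
Proof. by elim: n => [|n IH] a x y //=; rewrite IH linearP. Qed.

HB.instance Definition _ (S : {linear Y -> Y}) n :=
  GRing.isLinear.Build R[i] Y Y *:%R (iter n S) (linear_iter S n).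

(* Equivalent to strong Cesaro boundedness by duality, but it is a condition on
   norms only, so that it can be transferred to the adjoint. *)
Definition weighted_sum_bound (S : Y -> Y) (C : R) :=
  forall (a : nat -> R[i]) (n : nat) (y : Y), (forall k, rnorm (a k : R[i]^o) <= 1) ->
    rnorm (\sum_(k < n) a k *: iter k S y) <= C * n%:R * rnorm y.

Variables (S : {linear Y -> Y}) (C : R).
Hypotheses (C0 : 0 < C) (SC : weighted_sum_bound S C).

Lemma exists_block_sign (n M : nat) (y : Y) : (0 < M)%N -> (M.*2 <= n.+1)%N ->
  exists e : nat -> bool, rnorm (iter n S y) <=
    2 * C * rnorm (\sum_(k < n.+1 | (M <= n - k < M.*2)%N) (-1) ^+ e k *: iter k S y).
Proof.
move=> M0 Mn; pose P (k : 'I_n.+1) := (M <= n - k < M.*2)%N.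
have revE (k : 'I_n.+1) : (n - rev_ord k)%N = k.
  by rewrite /= subSS subKn// -ltnS.
have [|e] := @exists_sign_decoupling R Y 'I_n.+1 P (fun k => iter (n - k) S)
    (fun k => iter k S y) (C * M.*2%:R).
  (* Reversal turns the exponents [n - k] into [k]; the weights [a] vanish below [M], leaving a sum
     over [k < M.*2] to which [SC] applies. *)
  move=> e w; rewrite (reindex_inj rev_ord_inj)/=.
  pose a k : R[i] := if (M <= k)%N then (-1) ^+ e (rev_ord (inord k)) else 0.
  rewrite (_ : \sum_(j | _) _ = \sum_(k < M.*2) a k *: iter k S w); last first.
    rewrite (big_ord_widen _ (fun k => a k *: iter k S w) Mn).
    rewrite big_mkcond [RHS]big_mkcond; apply: eq_bigr => k _.
    rewrite /P revE /a inord_val; case: (k < M.*2)%N; rewrite ?andbT ?andbF//.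
    by case: ifP => // _; rewrite scale0r.
  apply: SC => k; rewrite /a; case: ifP => _; first by rewrite rnorm_sign.
  by rewrite rnorm0.
rewrite (eq_bigr (fun=> iter n S y)); last first.
  by move=> k _ /=; rewrite -iterD subnK// -ltnS.
(* Since [M.*2 <= n.+1], every integer of [[M, 2M)] is some [n - k], so the block has exactly [M]
   indices. *)
rewrite sumr_const (_ : #|P| = M); last first.
  rewrite -sum1_card (reindex_inj rev_ord_inj)/=.
  rewrite (eq_bigl (fun k : 'I_n.+1 => (M <= k)%N && (k < M.*2)%N)); last first.
    by move=> k; rewrite /in_mem/= /P revE.
  rewrite -(big_ord_widen_cond _ (leq M) (fun=> 1%N) Mn).
  have /= <- := @big_geq_mkord _ _ addn M M.*2 xpredT (fun=> 1%N); rewrite sum_nat_const_nat muln1.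
  by rewrite -addnn addnK.
rewrite -scaler_nat rnormZ -(rmorph_nat (real_complex R)) rnorm_real normr_nat => h.
exists (fun k => e (inord k)).
rewrite -(ler_pM2l (_ : 0 < M%:R :> R)) ?ltr0n// (le_trans h)//.
rewrite (eq_bigr (fun k : 'I_n.+1 => (-1) ^+ e (inord k) *: iter k S y)); last first.
  by move=> k _; rewrite inord_val.
rewrite /P -muln2 natrM le_eqVlt; apply/predU1P; left; ring.
Qed.

(** With [J] the truncated logarithm, [n < 2 ^ (J + 1)] and [ln 2 <= 1], while [J + 1 <= 2 J]
    because [J >= 1]. *)
Lemma ln_nat_le_trunc_log (n : nat) : (1 < n)%N -> ln n%:R <= 2 * (trunc_log 2 n)%:R :> R.
Proof.
move=> n1; have J0 : (0 < trunc_log 2 n)%N by rewrite trunc_log_gt0.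
have nlt := ltnW (trunc_log_ltn n (leqnn 2)).
have ln2 : ln 2 <= 1 :> R by rewrite [X in ln X](_ : _ = 1 + 1)// le_ln1Dx//; lra.
rewrite (@le_trans _ _ (ln (2 ^+ (trunc_log 2 n).+1)))//.
  by rewrite ler_ln ?posrE ?exprn_gt0 ?ltr0n -?natrX ?ler_nat// (leq_trans _ n1).
rewrite lnXn// -[leLHS]mulr_natl (@le_trans _ _ (trunc_log 2 n).+1%:R)//.
  by rewrite ler_piMr.
by rewrite -natrM ler_nat mul2n -addnn -add1n leq_add2r.
Qed.

Lemma rademacher_mean_le (n : nat) (F : {ffun 'I_n -> bool} -> R) (B : R) :
  (forall e, F e <= B) -> rademacher_mean F <= B.
Proof.
move=> FB; rewrite /rademacher_mean ler_pdivrMl ?exprn_gt0//.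
rewrite (le_trans (ler_sum _ (fun e _ => FB e)))//.
by rewrite sumr_const card_ffun card_bool card_ord -natrX mulr_natl.
Qed.

Lemma cotype_growth (q : R) : 0 < q -> finite_cotype Y q ->
  exists2 D : R, 0 < D & forall n y, (1 < n)%N ->
    rnorm (iter n S y) <= D * (n%:R / ln n%:R `^ q^-1) * rnorm y.
Proof.
move=> q0 [K K0 YK].
have D0 : 0 < 2 * C * (2 * K) `^ q^-1 * (2 * C) by rewrite !mulr_gt0// powR_gt0// mulr_gt0.
(* The first [2 * C] comes from the block estimate, [2 * K] from cotype and [ln n <= 2 J], the last
   [2 * C] from [C (n + 1) <= 2 C n]. *)
exists (2 * C * (2 * K) `^ q^-1 * (2 * C)) => // n y n1.
pose J := trunc_log 2 n.
have J0 : (0 < J)%N by rewrite trunc_log_gt0.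
have n0 : (0 < n)%N by exact: ltnW.
have ln0 : 0 < ln n%:R :> R by rewrite ln_gt0// ltr1n.
(* Every block fits: [2 ^ (j + 1) <= 2 ^ J <= n]. *)
have Jn (j : 'I_J) : ((2 ^ j).*2 <= n.+1)%N.
  rewrite -mul2n -expnS (leq_trans (leq_pexp2l _ (ltn_ord j)))//.
  by rewrite (leq_trans (trunc_logP (leqnn 2) n0)).
have /choice[e eP] (j : 'I_J) := exists_block_sign y (expn_gt0 2 j) (Jn j).
pose P (j : 'I_J) (k : 'I_n.+1) := (2 ^ j <= n - k < (2 ^ j).*2)%N.
pose u (j : 'I_J) := \sum_(k < n.+1 | P j k) (-1) ^+ e j k *: iter k S y.
(* A lower bound common to all block norms, by [exists_block_sign]. *)
pose L := rnorm (iter n S y) / (2 * C).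
have L0 : 0 <= L by rewrite divr_ge0 ?rnorm_ge0// mulr_ge0// ltW.
have Lu j : L <= rnorm (u j).
  by rewrite ler_pdivrMr ?mulr_gt0// mulrC; exact: eP.
have uB d : rnorm (rademacher_sum u d) <= C * n.+1%:R * rnorm y.
  pose a k : R[i] := \sum_(j < J | P j (inord k)) (-1) ^+ d j * (-1) ^+ e j k.
  rewrite (_ : rademacher_sum u d = \sum_(k < n.+1) a k *: iter k S y).
    apply: SC => k; rewrite (le_trans (@rnorm_sum R R[i]^o _ _ _ _))//.
    rewrite (eq_bigr (fun=> 1)); last by move=> j _; rewrite -signr_addb rnorm_sign.
    (* The dyadic ranges are disjoint: [j] must be the truncated logarithm of [n - k], so at most
       one block contributes to the weight at [k]. *)
    rewrite sumr_const lern1; apply/card_le1_eqP => i j.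
    rewrite /in_mem/= /P -!mul2n -!expnS => iP jP; apply/val_inj => /=.
    by rewrite -(trunc_log_eq _ iP)// -(trunc_log_eq _ jP).
  rewrite /rademacher_sum; under eq_bigr do rewrite scaler_sumr big_mkcond.
  rewrite exchange_big/=; apply: eq_bigr => k _.
  rewrite /a inord_val scaler_suml [RHS]big_mkcond; apply: eq_bigr => j _.
  by case: ifP => // _; rewrite scalerA.
have JL : J%:R * L `^ q <= K * (C * n.+1%:R * rnorm y) `^ q.
  rewrite (@le_trans _ _ (\sum_(j < J) rnorm (u j) `^ q))//.
    rewrite mulr_natl -[X in _ *+ X](card_ord J) -sumr_const ler_sum// => j _.
    by rewrite ge0_ler_powR ?nnegrE ?rnorm_ge0// ltW.
  rewrite (le_trans (YK _ _ J0))// ler_pM2l//; apply: rademacher_mean_le => d.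
  by rewrite ge0_ler_powR ?nnegrE ?rnorm_ge0 ?mulr_ge0 ?rnorm_ge0// ltW.
have lnL : ln n%:R * L `^ q <= 2 * K * (2 * C * n%:R * rnorm y) `^ q.
  rewrite (@le_trans _ _ (2 * (J%:R * L `^ q)))//.
    by rewrite mulrA ler_wpM2r ?powR_ge0//; exact: ln_nat_le_trunc_log.
  rewrite -mulrA ler_pM2l// (le_trans JL)// ler_pM2l//.
  rewrite ge0_ler_powR ?nnegrE ?mulr_ge0 ?rnorm_ge0// ?(ltW C0)// ?(ltW q0)//.
  rewrite ler_wpM2r ?rnorm_ge0// [2 * C]mulrC -mulrA ler_pM2l//.
  by rewrite -natrM ler_nat mul2n -addnn -addn1 leq_add2l.
pose b := 2 * C * n%:R * rnorm y.
have b0 : 0 <= b by rewrite !mulr_ge0 ?rnorm_ge0// ltW.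
have h : ln n%:R `^ q^-1 * L <= (2 * K) `^ q^-1 * b.
  by apply: ler_mul_powR_inv => //; rewrite ?mulr_ge0// ltW.
have l0 : 0 < ln n%:R `^ q^-1 :> R by rewrite powR_gt0.
have -> : rnorm (iter n S y) = 2 * C * L by rewrite mulrC divfK// mulf_neq0// gt_eqF.
have -> : 2 * C * (2 * K) `^ q^-1 * (2 * C) * (n%:R / ln n%:R `^ q^-1) * rnorm y =
    2 * C * ((2 * K) `^ q^-1 * b / ln n%:R `^ q^-1).
  rewrite /b; field; exact: lt0r_neq0.
by rewrite ler_pM2l ?mulr_gt0// ler_pdivlMr// mulrC.
Qed.

End cotype_growth.

(** * The adjoint operator and weighted sums of powers *)

Section adjoint.
Context {R : realType} {X : normedModType R[i]}.
Implicit Types (f : dual X) (x : X).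

Lemma dual_sumE (I : Type) (r : seq I) (P : pred I) (F : I -> dual X) x :
  (\sum_(i <- r | P i) F i) x = \sum_(i <- r | P i) F i x.
Proof. exact: (big_morph (fun f : dual X => f x)). Qed.

Variable (T : {linear X -> X}).

Section adjoint_def.
Hypothesis cT : continuous T.

Lemma adjoint_subproof f : (f \o T : X -> R[i]^o) \in @dual_pred R X.
Proof.
rewrite inE; split=> [a x y|x]; first by rewrite /= !linearP.
by apply: continuous_comp; [exact: cT|exact: dual_continuous].
Qed.

Definition adjoint f : dual X := Dual (adjoint_subproof f).

Lemma adjoint_linear : linear adjoint.
Proof. by move=> a f g; apply/val_inj/funext. Qed.

HB.instance Definition _ :=
  GRing.isLinear.Build R[i] (dual X) (dual X) *:%R adjoint adjoint_linear.

Lemma iter_adjoint n f x : iter n adjoint f x = f (iter n T x).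
Proof. by elim: n x => [|n IH] x //; rewrite [iter _ T _]iterSr -IH. Qed.

End adjoint_def.

Section weighted_sums.
Variable C : R.
Hypothesis TC : forall x f n, (0 < n)%N ->
  n%:R^-1 * \sum_(k < n) rnorm (f (iter k T x)) <= C * rnorm f * rnorm x.

Lemma weighted_orbit_le (a : nat -> R[i]) n f x :
  (forall k, rnorm (a k : R[i]^o) <= 1) ->
  rnorm (\sum_(k < n) a k *: f (iter k T x) : R[i]^o) <= C * n%:R * rnorm f * rnorm x.
Proof.
(* The case [n = 0] is separate because [TC] concerns positive [n]. *)
move=> a1; case: n => [|n]; first by rewrite big_ord0 rnorm0 mulr0 !mul0r.
rewrite (le_trans (@rnorm_sum R R[i]^o _ _ _ _))//.
rewrite (@le_trans _ _ (\sum_(k < n.+1) rnorm (f (iter k T x))))//.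
  by apply: ler_sum => k _; rewrite rnormZ ler_piMl ?rnorm_ge0.
have := TC x f (ltn0Sn n); rewrite ler_pdivrMl ?ltr0n// => /le_trans; apply.
by rewrite !mulrA [n.+1%:R * C]mulrC.
Qed.

Lemma weighted_sum_bound_operator : 0 <= C -> weighted_sum_bound T C.
Proof.
move=> C0 a n x a1; apply: le_rnorm_dual; last by rewrite !mulr_ge0 ?rnorm_ge0.
move=> f; rewrite linear_sum mulrAC.
under [in leLHS]eq_bigr do rewrite linearZ/=.
exact: weighted_orbit_le.
Qed.

(** The dual norm is a supremum over the unit ball, and evaluation at [x] gives the same scalar sums
    as for [T]. *)
Lemma weighted_sum_bound_adjoint (cT : continuous T) :
  0 <= C -> weighted_sum_bound (adjoint cT) C.
Proof.
move=> C0 a n f a1; rewrite rnorm_dualE.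
apply: (opnorm_le (@dual_continuous R X _)) => x x1.
rewrite -[X in rnorm X]/((\sum_(k < n) a k *: iter k (adjoint cT) f : dual X) x).
rewrite dual_sumE (eq_bigr (fun k : 'I_n => a k *: f (iter k T x))); last first.
  by move=> k _; rewrite -(iter_adjoint cT).
by rewrite (le_trans (weighted_orbit_le _ _ _ a1))// ler_piMr// !mulr_ge0 ?rnorm_ge0.
Qed.

(** Weights concentrated on the last of [n + 1] terms isolate the power [n]. This settles the case
    of infinite cotype. *)
Lemma iter_linear_growth n x : 0 <= C -> (0 < n)%N ->
  rnorm (iter n T x) <= 2 * C * n%:R * rnorm x.
Proof.
move=> C0 n0; pose a k : R[i] := (k == n)%:R.
have a1 k : rnorm (a k : R[i]^o) <= 1.
  rewrite /a; case: eqP => _; last by rewrite rnorm0.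
  by rewrite -(expr0 (-1)) rnorm_sign.
have := weighted_sum_bound_operator C0 n.+1 x a1.
rewrite big_ord_recr/= big1; last first.
  by move=> k _; rewrite /a (ltn_eqF (ltn_ord k)) scale0r.
rewrite add0r /a eqxx scale1r => /le_trans; apply.
rewrite ler_wpM2r ?rnorm_ge0// [2 * C]mulrC -mulrA ler_wpM2l//.
by rewrite -natrM ler_nat mul2n -addnn -addn1 leq_add2l.
Qed.

End weighted_sums.

End adjoint.

(** * Growth of the operator norms and its asymptotic form *)

Lemma opnorm_iter_growth (R : realType) (X : normedModType R[i])
    (T : {linear X -> X}) (q q' : \bar R) :
  continuous T -> strongly_cesaro_bounded T ->
  cotype X q -> cotype (dual X) q' ->
  exists2 D : R, 0 < D & forall n, (1 < n)%N ->
    opnorm (iter n T) <= D * (n%:R / ln n%:R `^ fine (Order.min q q')^-1%E).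
Proof.
move=> cT [C C0 TC] Xq Xq'.
have C1 := ltW C0.
suff [D D0 TD] : exists2 D : R, 0 < D & forall n x, (1 < n)%N -> rnorm (iter n T x) <=
    D * (n%:R / ln n%:R `^ fine (Order.min q q')^-1%E) * rnorm x.
  exists D => // n n1; apply: ge_sup.
    by exists (rnorm (iter n T 0)), 0 => //=; rewrite rnorm0.
  move=> _ [x /= x1 <-]; rewrite (le_trans (TD _ _ n1))// ler_piMr// mulr_ge0//.
    exact: ltW.
  by rewrite divr_ge0// powR_ge0.
have fine_inve (r : R) : 2 <= r -> fine (r%:E^-1)%E = r^-1.
  by move=> r2; rewrite inver gt_eqF//; lra.
(* The smaller exponent decides which operator is used: [T] on [X] first, its adjoint on [dual X]
   afterwards. *)
have [qq'|qq'] := leP q q'.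
  case: q Xq {qq'} => [r [r2 Xr]|_|//].
    rewrite fine_inve//; apply: (@cotype_growth _ _ _ C) => //.
    - exact: weighted_sum_bound_operator.
    - exact: lt_le_trans r2.
  exists (2 * C) => [|n x n1]; first by rewrite mulr_gt0.
  (* For [q = +oo] the inverse is [0], so the logarithmic factor is [1]. *)
  rewrite invey/= powRr0 divr1; apply: iter_linear_growth => //.
  exact: ltnW.
case: q' Xq' qq' => [r [r2 Xr]|_|//] qq'; last by move: qq'; rewrite ltNge leey.
have r0 : 0 < r by exact: lt_le_trans r2.
have [D D0 DT] :=
  @cotype_growth _ _ (adjoint cT) C C0 (weighted_sum_bound_adjoint TC cT C1) r r0 Xr.
rewrite fine_inve//; exists D => // n x n1.
(* The bound returns from the adjoint to [T] by testing [iter n T x] against functionals. *)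
apply: le_rnorm_dual; last first.
  by rewrite !mulr_ge0 ?rnorm_ge0 ?invr_ge0 ?powR_ge0// ltW.
move=> f; rewrite -(iter_adjoint cT).
rewrite (le_trans (ler_opnorm (@dual_continuous R X _) x))// mulrAC.
by rewrite ler_wpM2r ?rnorm_ge0//; exact: DT.
Qed.

Theorem proposition3p5 (R : realType) (X : completeNormedModType R[i])
    (T : {linear X -> X}) (q q' : \bar R) :
  continuous T -> strongly_cesaro_bounded T ->
  (2%:E <= q)%E -> (2%:E <= q')%E -> cotype X q -> cotype (dual X) q' ->
  let s := Order.min q q' in
  let normT := (fun n => opnorm (iter n T)) : nat -> R^o in
  normT =O_\oo (fun n => n%:R / ln n%:R `^ fine (s^-1)%E : R^o) /\
  ((s < +oo)%E -> normT =o_\oo (fun n => n%:R : R^o)).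
Proof.
move=> cT TC q2 q'2 Xq Xq' s normT.
have [D D0 TD] := opnorm_iter_growth cT TC Xq Xq'.
have normT0 n : 0 <= normT n.
  apply: (@opnorm_ge0 R X X (iter n T)).
  by elim: n => [|n IH] x; [exact: cvg_id|apply: continuous_comp; [exact: IH|exact: cT]].
have g0 n : 0 <= n%:R / ln n%:R `^ fine (s^-1)%E :> R by rewrite divr_ge0// powR_ge0.
split.
  apply/eqO_exP; exists D => //; near=> n.
  rewrite !ger0_norm//; apply: TD.
  by near: n; exists 2%N.
have s2 : (2%:E <= s)%E by rewrite le_min q2.
move=> soo; have [r r2 sE] : exists2 r : R, 2 <= r & s = r%:E.
  by move: s2 soo; case: (s) => [r r2 _|//|//]; exists r.
have r0 : 0 < r by exact: lt_le_trans r2.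
apply/eqoP => eps eps0; near=> n.
have n1 : (1 < n)%N by near: n; exists 2%N.
(* Past this threshold [(ln n) ^ (1 / r) >= D / eps], so [D n / (ln n) ^ (1 / r) <= eps n]. *)
have nlarge : expR ((D / eps) `^ r) <= n%:R by near: n; exact: nbhs_infty_ger.
have De0 : 0 <= D / eps by rewrite divr_ge0// ltW.
have ln0 : 0 < ln n%:R :> R by rewrite ln_gt0// ltr1n.
have lnlarge : D / eps <= ln n%:R `^ r^-1.
  have -> : D / eps = ((D / eps) `^ r) `^ r^-1.
    by rewrite -powRrM mulfV ?lt0r_neq0// powRr1.
  rewrite ge0_ler_powR ?nnegrE ?invr_ge0 ?powR_ge0 ?(ltW r0) ?(ltW ln0)//.
  by rewrite -ler_expR lnK// posrE ltr0n ltnW.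
rewrite !ger0_norm// (le_trans (TD n n1))// -/s sE inver gt_eqF//=.
rewrite mulrA ler_pdivrMr ?powR_gt0//.
move: lnlarge; rewrite ler_pdivrMr// => /(ler_wpM2r (ler0n R n)) /le_trans; apply.
rewrite le_eqVlt; apply/predU1P; left; ring.
Unshelve. all: by end_near. Qed.
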